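(* Let $F:\mathcal{C}\to\mathcal{D}$ be a semiseparable functor and let $e:\mathrm{Id}_{\mathcal{C}}\to\mathrm{Id}_{\mathcal{C}}$ be the associated idempotent natural transformation. Then there is a unique functor $F_e:\mathcal{C}_e\to\mathcal{D}$ (necessarily separable) such that $F=F_e\circ H$, where $H:\mathcal{C}\to\mathcal{C}_e$ is the quotient functor. Furthermore, if $F$ also factors as $S\circ N$, where $S:\mathcal{E}\to\mathcal{D}$ is a separable functor and $N:\mathcal{C}\to\mathcal{E}$ is a naturally full functor, then there is a unique functor $N_e:\mathcal{C}_e\to\mathcal{E}$ (necessarily fully faithful) such that $N_e\circ H=N$ and $S\circ N_e=F_e$, and $e$ is also the idempotent natural transformation associated to $N$.
   Context: For a functor $F:\mathcal{C}\to\mathcal{D}$ let $\mathcal{F}^F:\mathrm{Hom}_{\mathcal{C}}(-,-)\to\mathrm{Hom}_{\mathcal{D}}(F-,F-)$ be the natural transformation (of functors $\mathcal{C}^{\mathrm{op}}\times\mathcal{C}\to\mathsf{Set}$) with $\mathcal{F}^F_{X,Y}(f)=F(f)$. $F$ is separable if there is a natural transformation $\mathcal{P}^F:\mathrm{Hom}_{\mathcal{D}}(F-,F-)\to\mathrm{Hom}_{\mathcal{C}}(-,-)$ with $\mathcal{P}^F\circ\mathcal{F}^F=\mathrm{Id}$; naturally full if there is such a $\mathcal{P}^F$ with $\mathcal{F}^F\circ\mathcal{P}^F=\mathrm{Id}$; semiseparable if there is such a $\mathcal{P}^F$ with $\mathcal{F}^F\circ\mathcal{P}^F\circ\mathcal{F}^F=\mathcal{F}^F$.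 Separable and naturally full functors are semiseparable. Associated idempotent: for $F$ semiseparable, the associated idempotent natural transformation $e:\mathrm{Id}_{\mathcal{C}}\to\mathrm{Id}_{\mathcal{C}}$ is the unique idempotent natural transformation with $Fe=\mathrm{Id}_F$ such that for all $f,g:A\to B$ in $\mathcal{C}$, $Ff=Fg$ if and only if $e_B\circ f=e_B\circ g$; explicitly $e_X=\mathcal{P}^F_{X,X}(\mathrm{Id}_{FX})$ for any $\mathcal{P}^F$ with $\mathcal{F}^F\circ\mathcal{P}^F\circ\mathcal{F}^F=\mathcal{F}^F$. Coidentifier: for an idempotent natural transformation $e:\mathrm{Id}_{\mathcal{C}}\to\mathrm{Id}_{\mathcal{C}}$, the category $\mathcal{C}_e$ is the quotient of $\mathcal{C}$ with the same objects and $\mathrm{Hom}_{\mathcal{C}_e}(A,B)=\mathrm{Hom}_{\mathcal{C}}(A,B)/\sim$, where $f\sim g$ iff $e_B\circ f=e_B\circ g$. The quotient functor $H:\mathcal{C}\to\mathcal{C}_e$ is the identity on objects and the canonical projection on morphisms. Equalities of functors are strict. *)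

(* Defs.v *)
From mathcomp Require Import all_boot.
From mathcomp Require Import boolp.

Set Implicit Arguments.
Unset Strict Implicit.
Unset Printing Implicit Defensive.

Declare Scope cat_scope.
Delimit Scope cat_scope with cat.
Local Open Scope cat_scope.
Local Open Scope quotient_scope.

#[local] Obligation Tactic := try by [].

(* Laws are stated with Leibniz equality, so that [=] on [functor] is strict
   equality of functors. *)
Record category := Category {
  obj :> Type;
  hom : obj -> obj -> Type;
  idm : forall X, hom X X;
  compm : forall X Y Z, hom Y Z -> hom X Y -> hom X Z;
  compm1 : forall X Y (f : hom X Y), compm f (idm X) = f;
  comp1m : forall X Y (f : hom X Y), compm (idm Y) f = f;
  compmA : forall X Y Z T (h : hom Z T) (g : hom Y Z) (f : hom X Y),
    compm h (compm g f) = compm (compm h g) f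
}.
Arguments hom {c} X Y.
Arguments idm {c} X.
Arguments compm {c X Y Z} g f : rename.

Notation "g \oc f" := (compm g f) (at level 40, left associativity) : cat_scope.

Record functor (C D : category) := Functor {
  fobj :> C -> D;
  fmap : forall X Y, hom X Y -> hom (fobj X) (fobj Y);
  fmap1 : forall X, fmap (idm X) = idm (fobj X);
  fmapM : forall X Y Z (g : hom Y Z) (f : hom X Y),
    fmap (g \oc f) = fmap g \oc fmap f
}.
Arguments fmap {C D} F {X Y} f : rename.

Program Definition id_functor (C : category) : functor C C :=
  @Functor C C (fun X => X) (fun _ _ f => f) _ _.

Program Definition comp_functor (A B C : category)
    (G : functor B C) (F : functor A B) : functor A C :=
  @Functor A C (fun X => G (F X)) (fun _ _ f => fmap G (fmap F f)) _ _.
Next Obligation. by move=> A B C G F X; rewrite /= !fmap1. Qed.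
Next Obligation. by move=> A B C G F X Y Z g f; rewrite /= !fmapM. Qed.

Notation "G \of F" := (comp_functor G F)
  (at level 40, left associativity) : cat_scope.

Record nat_trans (C D : category) (F G : functor C D) := NatTrans {
  component :> forall X, hom (F X) (G X);
  naturality : forall X Y (f : hom X Y),
    component Y \oc fmap F f = fmap G f \oc component X
}.

Lemma nat_trans_ext (C D : category) (F G : functor C D) (a b : nat_trans F G) :
  (forall X, a X = b X) -> a = b.
Proof.
case: a b => [a Ha] [b Hb] /= ab.
have {}ab : a = b by apply: functional_extensionality_dep.
by move: Hb; rewrite -ab => Hb; congr NatTrans; apply: Prop_irrelevance.
Qed.

Program Definition nat_id (C D : category) (F : functor C D) : nat_trans F F :=
  @NatTrans C D F F (fun X => idm (F X)) _.
Next Obligation. by move=> C D F X Y f; rewrite comp1m compm1. Qed.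

Program Definition nat_comp (C D : category) (F G K : functor C D)
    (b : nat_trans G K) (a : nat_trans F G) : nat_trans F K :=
  @NatTrans C D F K (fun X => b X \oc a X) _.
Next Obligation.
by move=> C D F G K b a X Y f; rewrite -compmA naturality !compmA naturality.
Qed.

Notation "b \on a" := (nat_comp b a)
  (at level 40, left associativity) : cat_scope.

Program Definition op (C : category) : category :=
  @Category C (fun X Y => hom Y X) idm (fun _ _ _ g f => f \oc g) _ _ _.
Next Obligation. by move=> *; rewrite /= comp1m. Qed.
Next Obligation. by move=> *; rewrite /= compm1. Qed.
Next Obligation. by move=> *; rewrite /= compmA. Qed.

Program Definition prod_cat (C D : category) : category :=
  @Category (C * D)%type (fun X Y => (hom X.1 Y.1 * hom X.2 Y.2)%type)
    (fun X => (idm X.1, idm X.2))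
    (fun _ _ _ g f => (g.1 \oc f.1, g.2 \oc f.2)) _ _ _.
Next Obligation. by move=> C D X Y [f g] /=; rewrite !compm1. Qed.
Next Obligation. by move=> C D X Y [f g] /=; rewrite !comp1m. Qed.
Next Obligation. by move=> *; rewrite /= !compmA. Qed.

Program Definition set_cat : category :=
  @Category Type (fun X Y => X -> Y) (fun _ x => x)
    (fun _ _ _ g f x => g (f x)) _ _ _.

Program Definition op_functor (C D : category) (F : functor C D) :
    functor (op C) (op D) :=
  @Functor (op C) (op D) F (fun _ _ f => fmap F f) _ _.
Next Obligation. by move=> *; apply: fmap1. Qed.
Next Obligation. by move=> *; apply: fmapM. Qed.

Program Definition prod_functor (A B C D : category)
    (F : functor A C) (G : functor B D) :
    functor (prod_cat A B) (prod_cat C D) :=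
  @Functor (prod_cat A B) (prod_cat C D) (fun X => (F X.1, G X.2))
    (fun _ _ f => (fmap F f.1, fmap G f.2)) _ _.
Next Obligation. by move=> *; rewrite /= !fmap1. Qed.
Next Obligation. by move=> *; rewrite /= !fmapM. Qed.

Program Definition hom_functor (C : category) :
    functor (prod_cat (op C) C) set_cat :=
  @Functor (prod_cat (op C) C) set_cat (fun X => hom (c := C) X.1 X.2)
    (fun _ _ u h => compm (c := C) u.2 (compm (c := C) h u.1)) _ _.
Next Obligation.
by move=> C X; apply: functional_extensionality_dep => h /=; rewrite compm1 comp1m.
Qed.
Next Obligation.
by move=> C X Y Z g f; apply: functional_extensionality_dep => h /=; rewrite !compmA.
Qed.

(* Hom_D(F-, F-) *)
Definition hom_functor_along (C D : category) (F : functor C D) :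
    functor (prod_cat (op C) C) set_cat :=
  hom_functor D \of prod_functor (op_functor F) F.

(* The transformation F^F : Hom_C(-,-) -> Hom_D(F-,F-), f |-> F f *)
Program Definition fmap_nat (C D : category) (F : functor C D) :
    nat_trans (hom_functor C) (hom_functor_along F) :=
  @NatTrans _ _ (hom_functor C) (hom_functor_along F)
    (fun X (f : hom (c := C) X.1 X.2) => fmap F f) _.
Next Obligation.
by move=> C D F X Y u; apply: functional_extensionality_dep => h /=; rewrite !fmapM.
Qed.

Definition separable (C D : category) (F : functor C D) : Prop :=
  exists P : nat_trans (hom_functor_along F) (hom_functor C),
    P \on fmap_nat F = nat_id (hom_functor C).

Definition naturally_full (C D : category) (F : functor C D) : Prop :=
  exists P : nat_trans (hom_functor_along F) (hom_functor C),
    fmap_nat F \on P = nat_id (hom_functor_along F).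

Definition semiseparable (C D : category) (F : functor C D) : Prop :=
  exists P : nat_trans (hom_functor_along F) (hom_functor C),
    fmap_nat F \on P \on fmap_nat F = fmap_nat F.

Definition fully_faithful (C D : category) (F : functor C D) : Prop :=
  forall X Y : C, bijective (@fmap C D F X Y).

Definition idempotent_nat (C : category)
    (e : nat_trans (id_functor C) (id_functor C)) : Prop := e \on e = e.

(* For semiseparable [F] exactly one [e] satisfies this predicate: see
   [associated_idempotent_exists_unique]. *)
Definition associated_idempotent (C D : category) (F : functor C D)
    (e : nat_trans (id_functor C) (id_functor C)) : Prop :=
  [/\ idempotent_nat e,
      forall X : C, fmap F (e X) = idm (F X) &
      forall (A B : C) (f g : hom A B),
        fmap F f = fmap F g <-> e B \oc f = e B \oc g].

Lemma associated_idempotent_unique (C D : category) (F : functor C D)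
    (e e' : nat_trans (id_functor C) (id_functor C)) :
  associated_idempotent F e -> associated_idempotent F e' -> e = e'.
Proof.
case=> _ Fe eP [_ Fe' e'P]; apply: nat_trans_ext => X.
have /eP : fmap F (e' X) = fmap F (idm X) by rewrite Fe' fmap1.
have /e'P : fmap F (e X) = fmap F (idm X) by rewrite Fe fmap1.
rewrite !compm1 => e'e ee'; rewrite -ee' -[RHS]e'e.
exact: esym (naturality e' (e X)).
Qed.

(* The formula e_X = P_{X,X}(Id_{FX}). *)
Lemma associated_idempotentE (C D : category) (F : functor C D)
    (P : nat_trans (hom_functor_along F) (hom_functor C))
    (e : nat_trans (id_functor C) (id_functor C)) :
  fmap_nat F \on P \on fmap_nat F = fmap_nat F ->
  (forall X : C, e X = P (X, X) (idm (F X))) -> associated_idempotent F e.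
Proof.
move=> FPF eE.
have FPFE (X Y : C) (f : hom X Y) : fmap F (P (X, Y) (fmap F f)) = fmap F f.
  exact: (congr1 (fun a : nat_trans (hom_functor C) (hom_functor_along F) =>
    component a (X, Y) f) FPF).
have Pr (X Y : C) (f : hom X Y) : P (X, Y) (fmap F f) = e Y \oc f.
  have := @naturality _ _ _ _ P (Y, Y) (X, Y) (f, idm Y).
  move=> /(congr1 (fun u => u (idm (F Y)))) /=.
  by rewrite fmap1 !comp1m -eE.
have Fe (X : C) : fmap F (e X) = idm (F X) by rewrite eE -fmap1 FPFE.
have eP (A B : C) (f g : hom A B) : fmap F f = fmap F g <-> e B \oc f = e B \oc g.
  split=> [fg|]; first by rewrite -!Pr fg.
  by move=> /(congr1 (fmap F)); rewrite !fmapM Fe !comp1m.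
split=> //; apply: nat_trans_ext => X /=.
by rewrite -Pr Fe eE.
Qed.

Lemma associated_idempotent_exists_unique (C D : category) (F : functor C D) :
  semiseparable F -> exists! e, associated_idempotent F e.
Proof.
case=> P FPF.
have nat_e (X Y : C) (f : hom X Y) :
  P (Y, Y) (idm (F Y)) \oc fmap (id_functor C) f =
  fmap (id_functor C) f \oc P (X, X) (idm (F X)).
  have := @naturality _ _ _ _ P (Y, Y) (X, Y) (f, idm Y).
  move=> /(congr1 (fun u => u (idm (F Y)))) /=; rewrite fmap1 !comp1m => <-.
  have := @naturality _ _ _ _ P (X, X) (X, Y) (idm X, f).
  by move=> /(congr1 (fun u => u (idm (F X)))) /=; rewrite fmap1 !compm1 => <-.
pose e := @NatTrans _ _ (id_functor C) (id_functor C) _ nat_e.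
have eP : associated_idempotent F e by apply: associated_idempotentE FPF _.
by exists e; split=> // e'; apply: associated_idempotent_unique.
Qed.

Section Coidentifier.
Variables (C : category) (e : nat_trans (id_functor C) (id_functor C)).

Definition coid_rel (A B : C) : rel {classic (hom A B)} :=
  fun f g => `[< e B \oc f = e B \oc g >].

Lemma coid_rel_refl A B : reflexive (@coid_rel A B).
Proof. by move=> f; apply/asboolP. Qed.

Lemma coid_rel_sym A B : symmetric (@coid_rel A B).
Proof. by move=> f g; apply/asboolP/asboolP. Qed.

Lemma coid_rel_trans A B : transitive (@coid_rel A B).
Proof. by move=> g f h /asboolP fg /asboolP gh; apply/asboolP; rewrite fg. Qed.

Definition coid_equiv (A B : C) : equiv_rel {classic (hom A B)} :=
  EquivRel (@coid_rel A B) (@coid_rel_refl A B) (@coid_rel_sym A B)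
    (@coid_rel_trans A B).

Definition coid_hom (A B : C) : Type := {eq_quot coid_equiv A B}.

Definition coid_pi (A B : C) (f : hom A B) : coid_hom A B :=
  \pi_({eq_quot coid_equiv A B}) (f : {classic (hom A B)}).

Definition coid_repr (A B : C) (q : coid_hom A B) : hom A B :=
  repr (q : {eq_quot coid_equiv A B}).

Lemma coid_piP (A B : C) (f g : hom A B) :
  coid_pi f = coid_pi g <-> e B \oc f = e B \oc g.
Proof.
split=> [fg|fg]; last by apply/eqmodP/asboolP.
by apply/asboolP; move/eqmodP: fg.
Qed.

Lemma coid_reprK (A B : C) (q : coid_hom A B) : coid_pi (coid_repr q) = q.
Proof. exact: reprK. Qed.

Lemma coid_repr_pi (A B : C) (f : hom A B) :
  e B \oc coid_repr (coid_pi f) = e B \oc f.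
Proof. by apply/coid_piP; rewrite coid_reprK. Qed.

Lemma coid_pi_comp (X Y Z : C) (g g' : hom Y Z) (f f' : hom X Y) :
  coid_pi g = coid_pi g' -> coid_pi f = coid_pi f' ->
  coid_pi (g \oc f) = coid_pi (g' \oc f').
Proof.
move=> /coid_piP gg' /coid_piP ff'; apply/coid_piP.
have nat_g' : e Z \oc g' = g' \oc e Y by exact: (naturality e g').
by rewrite compmA gg' nat_g' -compmA ff' compmA -nat_g' compmA.
Qed.

Definition coid_comp (X Y Z : C) (q : coid_hom Y Z) (p : coid_hom X Y) :
  coid_hom X Z := coid_pi (coid_repr q \oc coid_repr p).

Lemma coid_compE (X Y Z : C) (g : hom Y Z) (f : hom X Y) :
  coid_comp (coid_pi g) (coid_pi f) = coid_pi (g \oc f).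
Proof. by apply: coid_pi_comp; rewrite coid_reprK. Qed.

(* C_e; idempotency of [e] is not needed for the construction. *)
Program Definition coid_cat : category :=
  @Category C coid_hom (fun X => coid_pi (idm X)) coid_comp _ _ _.
Next Obligation. by move=> X Y q; rewrite -(coid_reprK q) coid_compE compm1. Qed.
Next Obligation. by move=> X Y q; rewrite -(coid_reprK q) coid_compE comp1m. Qed.
Next Obligation.
move=> X Y Z T r q p.
by rewrite -(coid_reprK r) -(coid_reprK q) -(coid_reprK p) !coid_compE compmA.
Qed.

Program Definition coid_quot : functor C coid_cat :=
  @Functor C coid_cat (fun X => X) (fun X Y f => coid_pi f) _ _.
Next Obligation. by move=> X Y Z g f; rewrite /= coid_compE. Qed.

End Coidentifier.

(* Main.v *)
Require Import Defs.
From mathcomp Require Import all_boot.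
From mathcomp Require Import boolp.
Local Open Scope cat_scope.

(** The quotient functor [H] is the identity on objects and full, so it is epi in
    the strict sense, and a functor descends along [H] as soon as it identifies
    the morphisms identified by [e]. For [F] this is one half of the defining
    property of [e]; the other half makes [H \o P^F] a retraction of the action of
    [F_e] on morphisms. If [F = S \o N] with [S] separable, then [S] is faithful,
    so [N] identifies the same morphisms as [F] and descends to a faithful
    functor, which is full because [N] is. *)

Definition functor_data (C D : category) (o : C -> D) : Type :=
  forall X Y : C, hom X Y -> hom (o X) (o Y).

(* Packing objects and morphisms in one sigma type avoids transporting morphisms
   along an equality of object maps. *)
Definition functor_tag (C D : category) (F : functor C D) :
    {o : C -> D & functor_data C D o} :=
  existT (functor_data C D) (fobj F) (@fmap C D F).

Lemma functor_tag_inj (C D : category) : injective (@functor_tag C D).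
Proof.
(* Quantifying over the law proofs lets the equality of data be rewritten as a whole; the laws then
   agree by proof irrelevance. *)
suff Functor_eq (p q : {o : C -> D & functor_data C D o}) : p = q ->
    forall p1 pM q1 qM,
    @Functor C D (tag p) (tagged p) p1 pM = @Functor C D (tag q) (tagged q) q1 qM.
  by case=> [o m m1 mM] [o' m' m1' mM'] /Functor_eq; apply.
by move=> -> p1 pM q1 qM; congr Functor; apply: Prop_irrelevance.
Qed.

Lemma coid_quot_epi (C K : category) (e : nat_trans (id_functor C) (id_functor C))
    (G G' : functor (coid_cat e) K) :
  G \of coid_quot e = G' \of coid_quot e -> G = G'.
Proof.
(* Evaluating the data of [G \of coid_quot e] at chosen representatives gives back the data of
   [G]. *)
pose lift (p : {o : C -> K & functor_data C K o}) :
    {o : coid_cat e -> K & functor_data (coid_cat e) K o} :=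
  existT (functor_data (coid_cat e) K) (tag p)
    (fun (X Y : coid_cat e) (q : hom X Y) => tagged p X Y (coid_repr q)).
have liftK (L : functor (coid_cat e) K) :
    lift (functor_tag _ _ (L \of coid_quot e)) = functor_tag _ _ L.
  rewrite /lift /functor_tag /=; congr existT.
  apply: functional_extensionality_dep => X.
  apply: functional_extensionality_dep => Y.
  by apply: funext => q; rewrite coid_reprK.
move=> GG'; apply: functor_tag_inj.
by rewrite -liftK GG' liftK.
Qed.

Section Descent.
Variables (C K : category) (e : nat_trans (id_functor C) (id_functor C)).
Variables (G : functor C K).
Hypothesis Ge : forall (A B : C) (f g : hom A B),
  e B \oc f = e B \oc g -> fmap G f = fmap G g.

Definition descent_map (X Y : coid_cat e) (q : hom X Y) : hom (G X) (G Y) :=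
  fmap G (coid_repr q).

Lemma descent_map_pi (X Y : C) (f : hom X Y) :
  descent_map X Y (coid_pi e f) = fmap G f.
Proof. by apply: Ge; rewrite coid_repr_pi. Qed.

Lemma descent_map1 (X : coid_cat e) : descent_map X X (idm X) = idm (G X).
Proof. by rewrite descent_map_pi fmap1. Qed.

Lemma descent_mapM (X Y Z : coid_cat e) (g : hom Y Z) (f : hom X Y) :
  descent_map X Z (g \oc f) = descent_map Y Z g \oc descent_map X Y f.
Proof. by rewrite /= descent_map_pi fmapM. Qed.

Definition descent : functor (coid_cat e) K :=
  @Functor (coid_cat e) K (fobj G) descent_map descent_map1 descent_mapM.

Lemma descentE : descent \of coid_quot e = G.
Proof.
apply: functor_tag_inj; rewrite /functor_tag /=; congr existT.
apply: functional_extensionality_dep => X.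
apply: functional_extensionality_dep => Y.
by apply: funext => f; apply: descent_map_pi.
Qed.

End Descent.
Arguments descent {C K e G} Ge.

(** At each pair of objects, the transformation that witnesses separability is a left inverse of the
    action on morphisms. *)
Lemma separable_faithful (C D : category) (F : functor C D) :
  separable F -> forall X Y : C, injective (@fmap C D F X Y).
Proof.
case=> P PF X Y; apply: (can_inj (g := P (X, Y))) => f.
exact: (congr1 (fun a : nat_trans (hom_functor C) (hom_functor C) =>
  component a (X, Y) f) PF).
Qed.

Lemma naturally_full_section (C D : category) (F : functor C D) :
  naturally_full F ->
  forall X Y : C, exists p : hom (F X) (F Y) -> hom X Y,
    cancel p (@fmap C D F X Y).
Proof.
case=> P FP X Y; exists (P (X, Y)) => f.
exact: (congr1 (fun a : nat_trans (hom_functor_along F) (hom_functor_along F) =>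
  component a (X, Y) f) FP).
Qed.

Lemma descent_separable (C D : category) (F : functor C D)
    (e : nat_trans (id_functor C) (id_functor C))
    (eF : forall (A B : C) (f g : hom A B),
      e B \oc f = e B \oc g -> fmap F f = fmap F g) :
  semiseparable F ->
  (forall (A B : C) (f g : hom A B),
    fmap F f = fmap F g -> e B \oc f = e B \oc g) ->
  separable (descent eF).
Proof.
case=> P FPF Fe.
have FPFE (X Y : C) (f : hom X Y) : fmap F (P (X, Y) (fmap F f)) = fmap F f.
  exact: (congr1 (fun a : nat_trans (hom_functor C) (hom_functor_along F) =>
    component a (X, Y) f) FPF).
pose p (X : prod_cat (op (coid_cat e)) (coid_cat e))
    (h : hom (F X.1) (F X.2)) : coid_hom e X.1 X.2 := coid_pi e (P (X.1, X.2) h).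
have p_nat (X Y : prod_cat (op (coid_cat e)) (coid_cat e)) (f : hom X Y) :
    compm (c := set_cat) (p Y) (fmap (hom_functor_along (descent eF)) f) =
    compm (c := set_cat) (fmap (hom_functor (coid_cat e)) f) (p X).
  case: X Y f => [X1 X2] [Y1 Y2] [u v]; apply: funext => h.
  rewrite /p /=.
  (* Naturality of [P] is used at chosen representatives of [u] and [v]; passing to classes removes
     the choices. *)
  have := @naturality _ _ _ _ P (X1, X2) (Y1, Y2) (coid_repr u, coid_repr v).
  move=> /(congr1 (fun k => k h)) /= ->.
  by rewrite -!coid_compE !coid_reprK.
exists (@NatTrans _ _ (hom_functor_along (descent eF)) (hom_functor (coid_cat e))
  p p_nat).
apply: nat_trans_ext => -[X Y]; apply: funext => q.
rewrite /= /p /= /descent_map -[RHS]coid_reprK.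
(* It suffices that [F] identifies [P (F f)] with [f], where [f] represents [q]; this is
   semiseparability. *)
by apply/coid_piP/Fe/FPFE.
Qed.

Theorem theorem1p15 (C D : category) (F : functor C D)
    (e : nat_trans (id_functor C) (id_functor C))
    (hF : semiseparable F) (he : associated_idempotent F e) :
  exists Fe : functor (coid_cat e) D,
    [/\ unique (fun G : functor (coid_cat e) D => F = G \of coid_quot e) Fe,
        separable Fe &
        forall (E : category) (S : functor E D) (N : functor C E),
          separable S -> naturally_full N -> F = S \of N ->
          exists Ne : functor (coid_cat e) E,
            [/\ unique (fun G : functor (coid_cat e) E =>
                  G \of coid_quot e = N /\ S \of G = Fe) Ne,
                fully_faithful Ne &
                associated_idempotent N e]].
Proof.
case: he => e_idem Fe1 FeP.
have eF (A B : C) (f g : hom A B) : e B \oc f = e B \oc g -> fmap F f = fmap F g.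
  by move/FeP.
exists (descent eF); split.
- split=> [|G FG]; first by rewrite descentE.
  by apply: coid_quot_epi; rewrite descentE.
- by apply: descent_separable => // A B f g /FeP.
move=> E S N sepS nfN FSN.
have S_inj := separable_faithful _ _ _ sepS.
have NP (A B : C) (f g : hom A B) :
    fmap N f = fmap N g <-> e B \oc f = e B \oc g.
  (* As [S] is faithful, [N f = N g] exactly when [S (N f) = S (N g)], that is, [F f = F g]. *)
  move: FeP; rewrite FSN => FeP.
  by split=> [fg|/FeP/S_inj//]; apply/FeP; rewrite /= fg.
have eN (A B : C) (f g : hom A B) : e B \oc f = e B \oc g -> fmap N f = fmap N g.
  by move/NP.
exists (descent eN); split.
- split=> [|G [GN _]]; last by apply: coid_quot_epi; rewrite descentE.
  split; first exact: descentE.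
  apply: coid_quot_epi; rewrite descentE FSN -{2}(descentE _ _ _ _ eN).
  (* The two bracketings of [S], [descent eN] and [coid_quot e] have the same data by
     computation. *)
  exact: functor_tag_inj.
- move=> X Y; have [p pK] := naturally_full_section _ _ _ nfN X Y.
  (* The inverse takes the class of a preimage under [N]; it recovers [q] because morphisms
     identified by [N] are identified by [e]. *)
  exists (fun h => coid_pi e (p h)) => [q|h]; last by rewrite /= descent_map_pi.
  by rewrite -[RHS]coid_reprK; apply/coid_piP/NP/pK.
(* [S (N (e X)) = F (e X)] is an identity, hence so is [N (e X)] by faithfulness of [S]. *)
- split=> // X; apply: S_inj; rewrite fmap1.
  by move: Fe1; rewrite FSN; apply.
Qed.
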